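(* Let $p\ge1$ and let $(\xi_t)_{t\in\mathbb Z}$ be i.i.d. symmetric centered real random variables with continuous distribution such that $\mathbb E|\xi_0|=1$ and $\mathbb E[\xi_0^2]<\infty$. Let $\Theta$ be a compact subset of $$\Theta_p(2)=\Big\{{}^t(a_0,a_1,\dots,a_p)\in(0,\infty)\times\mathbb R^p:\ \mathbb E[\xi_0^2]\sum_{j=1}^p a_j^2<1\Big\},$$ let $\theta^*={}^t(a_0^*,a_1^*,\dots,a_p^* )\in\Theta$, and let $(X_t)_{t\in\mathbb Z}$ be the stationary LARCH$(p)$ process with parameter $\theta^*$, i.e. the stationary solution of $$X_t=\xi_t\,\sigma_t,\qquad \sigma_t=a_0^*+\sum_{i=1}^p a_i^*X_{t-i},\qquad t\in\mathbb Z.$$ Let $\widehat\theta_n={}^t(\widehat a_0^{(n)},\dots,\widehat a_p^{(n)})$ be the estimator $$\widehat\theta_n=\operatorname*{Arg\,min}_{{}^t(a_0,\dots,a_p)\in\Theta}\ \frac1n\sum_{t=1}^n\Big(|X_t|-\Big|a_0+\sum_{j=1}^{\min(p,t-1)}a_jX_{t-j}\Big|\Big)^2 .$$ Then $\widehat\theta_n\to\theta^*$ almost surely as $n\to\infty$.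
   Context: The process $(X_t)$ is observed at times $1,\dots,n$. Under $\theta^*\in\Theta_p(2)$ the LARCH$(p)$ equation has a strictly stationary ergodic causal solution ($X_t$ is a measurable function of $(\xi_{t-j})_{j\ge0}$) with $\mathbb E[X_0^2]<\infty$; this is the solution considered. Empty sums are $0$. $\widehat\theta_n$ denotes a minimizer. *)

(* Defs.v *)
From HB Require Import structures.
From mathcomp Require Import all_boot all_order all_algebra.
From mathcomp Require Import all_classical all_reals all_analysis.

Set Implicit Arguments.
Unset Strict Implicit.
Unset Printing Implicit Defensive.

Import Order.TTheory GRing.Theory Num.Theory.
Import numFieldNormedType.Exports.

Local Open Scope classical_set_scope.
Local Open Scope ring_scope.

(* The product sigma-algebra on R^I is [<<s cylinders I R >>]. *)
Definition cylinders (I : Type) (R : realType) : set (set (I -> R)) :=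
  [set C | exists (i : I) (B : set R),
     measurable B /\ C = [set x | B (x i)]].

Definition path_shift (R : realType) (h : int) (x : int -> R) : int -> R :=
  fun t => x (t + h).

Section processes.
Context {d : measure_display} {T : measurableType d} {R : realType}.
Variable P : probability T R.

Definition sample_path (X : int -> {RV P >-> R}) (w : T) : int -> R :=
  fun t => X t w.

Definition mutually_independent (X : int -> {RV P >-> R}) : Prop :=
  forall (s : seq int) (B : int -> set R), uniq s ->
    (forall i, measurable (B i)) ->
    P (\bigcap_(i in [set` s]) (X i @^-1` B i)) =
    (\prod_(i <- s) P (X i @^-1` B i))%E.

Definition identically_distributed (X : int -> {RV P >-> R}) : Prop :=
  forall (i j : int) (B : set R), measurable B ->
    distribution P (X i) B = distribution P (X j) B.

Definition iid (X : int -> {RV P >-> R}) : Prop :=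
  mutually_independent X /\ identically_distributed X.

Definition symmetric_rv (Y : {RV P >-> R}) : Prop :=
  forall B : set R, measurable B ->
    P [set w | B (Y w)] = P [set w | B (- Y w)].

Definition strictly_stationary (X : int -> {RV P >-> R}) : Prop :=
  forall (h : int) (A : set (int -> R)), <<s @cylinders int R >> A ->
    P (sample_path X @^-1` A) =
    P ((path_shift h \o sample_path X) @^-1` A).

Definition ergodic (X : int -> {RV P >-> R}) : Prop :=
  forall A : set (int -> R), <<s @cylinders int R >> A ->
    path_shift 1 @^-1` A = A ->
    P (sample_path X @^-1` A) = 0%E \/ P (sample_path X @^-1` A) = 1%E.

Definition causal (xi X : int -> {RV P >-> R}) : Prop :=
  forall t : int, exists H : (nat -> R) -> R,
    (forall B : set R, measurable B -> <<s @cylinders nat R >> (H @^-1` B)) /\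
    {ae P, forall w, X t w = H (fun j : nat => xi (t - j%:Z) w)}.

End processes.

Section larch.
Context {R : realType} {p : nat}.

(* [coef theta j] is a_j for j <= p; [inord] is meaningless beyond p. *)
Definition coef (theta : 'rV[R]_p.+1) (j : nat) : R := theta ord0 (inord j).

Definition larch_sigma (theta : 'rV[R]_p.+1) (x : int -> R) (t : int) : R :=
  coef theta 0%N + \sum_(1 <= i < p.+1) coef theta i * x (t - i%:Z).

(* Only the observations x_1, ..., x_n occur in [larch_contrast theta x n]. *)
Definition larch_contrast (theta : 'rV[R]_p.+1) (x : int -> R) (n : nat) : R :=
  n%:R^-1 * \sum_(1 <= t < n.+1)
    (`|x t%:Z| - `|coef theta 0%N +
       \sum_(1 <= j < (minn p t.-1).+1) coef theta j * x (t%:Z - j%:Z)|) ^+ 2.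

Definition is_argmin (Theta : set 'rV[R]_p.+1) (f : 'rV[R]_p.+1 -> R)
    (theta : 'rV[R]_p.+1) : Prop :=
  Theta theta /\ forall theta', Theta theta' -> f theta <= f theta'.

Context {d : measure_display} {T : measurableType d}.
Variable P : probability T R.

(* The set Theta_p(2) for innovations distributed as Z. *)
Definition larch_params (Z : {RV P >-> R}) : set 'rV[R]_p.+1 :=
  [set theta | 0 < coef theta 0%N /\
    ('E_P[fun w => (Z w ^+ 2)%R] *
       (\sum_(1 <= j < p.+1) coef theta j ^+ 2)%R%:E < 1)%E].

Definition larch_equation (theta : 'rV[R]_p.+1) (xi X : int -> {RV P >-> R})
    : Prop :=
  forall t : int,
    {ae P, forall w, X t w = xi t w * larch_sigma theta (sample_path X w) t}.

Definition stationary_larch (theta : 'rV[R]_p.+1) (xi X : int -> {RV P >-> R})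
    : Prop :=
  [/\ larch_equation theta xi X, strictly_stationary X, ergodic X,
      causal xi X & ('E_P[fun w => (X 0 w ^+ 2)%R] < +oo)%E].

End larch.

(* Main.v *)
(* Let [m_t(theta)] be [larch_sigma theta X t], so that [X_t = xi_t m_t(theta_star)].
   As [xi_t] is independent of the past and [E|xi_t| = 1], the mean of
   [(|X_t| - |m_t(theta_star)|)^2 - (|X_t| - |m_t(theta)|)^2] is
   [- E (|m_t(theta_star)| - |m_t(theta)|)^2].  For [theta != theta_star] it is
   negative: otherwise [m_t(theta_star) - m_t(theta)] or [m_t(theta_star) + m_t(theta)],
   a nonzero affine form in the past of [X], would vanish with positive probability,
   which is impossible because the innovations are atomless and [m_t(theta_star) != 0]
   almost surely.  The mean remains negative for an upper bound of the difference of
   losses that is uniform over a small ball around [theta], and the partial sums of a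
   stationary ergodic sequence with negative mean are almost surely bounded above.
   Hence the estimator almost surely leaves that ball for good; compactness of [Theta]
   concludes. *)
Require Import Defs.
From HB Require Import structures.
From mathcomp Require Import all_boot all_order all_algebra.
From mathcomp Require Import all_classical all_reals all_analysis.
From mathcomp Require Import measurable_realfun.
From mathcomp Require Import zify ring lra.

Set Implicit Arguments.
Unset Strict Implicit.
Unset Printing Implicit Defensive.

Import Order.TTheory GRing.Theory Num.Theory.
Import numFieldNormedType.Exports.

Local Open Scope classical_set_scope.
Local Open Scope ring_scope.


(** * Sums of a stationary ergodic sequence with negative mean *)

Section maximal_ergodic.
Context {d : measure_display} {T : measurableType d} {R : realType}.
Variables (mu : probability T R) (tau : T -> T).
Hypothesis mtau : measurable_fun setT tau.
Hypothesis tau_pres : forall A, measurable A -> mu (tau @^-1` A) = mu A.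
Hypothesis tau_erg : forall A, measurable A -> tau @^-1` A = A ->
  mu A = 0%E \/ mu A = 1%E.

Lemma integral_measure_preserving (g : T -> R) : mu.-integrable setT (EFin \o g) ->
  mu.-integrable setT (EFin \o (g \o tau)) /\
  (\int[mu]_x (g (tau x))%:E = \int[mu]_x (g x)%:E)%E.
Proof.
move=> ig; have mg : measurable_fun setT g.
  by apply/measurable_EFinP; exact: measurable_int ig.
have mEg : measurable_fun [set: T] (fun x => (g x)%:E) by exact/measurable_EFinP.
have pE (A : set T) : measurable A -> A `<=` setT -> mu A = pushforward mu tau A.
  by move=> mA _; rewrite /pushforward tau_pres.
have ige : mu.-integrable setT (EFin \o (g \o tau)).
  apply/integrableP; split; first by apply/measurable_EFinP; exact: measurableT_comp.
  have /integrableP[_] := ig; apply: le_lt_trans.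
  rewrite [leRHS](eq_measure_integral (pushforward mu tau))//.
  rewrite ge0_integral_pushforward//; exact: measurableT_comp.
split=> //; rewrite [RHS](eq_measure_integral (pushforward mu tau))//.
by rewrite (integral_pushforward mtau mEg).
Qed.

Variable f : T -> R.
Hypothesis intf : mu.-integrable setT (EFin \o f).

(** Garsia's running maximum: the largest of the sums of the first [k] orbit terms over [k <= n],
    the empty sum included, written as a recursion that isolates the first term. *)
Fixpoint max_sum (n : nat) (x : T) : R :=
  if n is m.+1 then Num.max 0 (f x + max_sum m (tau x)) else 0.

Lemma max_sum_ge0 n x : 0 <= max_sum n x.
Proof. by case: n => //= n; rewrite le_max lexx. Qed.

Lemma sum_le_max_sum n x : \sum_(k < n) f (iter k tau x) <= max_sum n x.
Proof.
elim: n x => [|n IHn] x; first by rewrite big_ord0.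
rewrite big_ord_recl /= le_max; apply/orP; right; rewrite lerD2l.
apply: le_trans (IHn (tau x)).
by rewrite le_eqVlt; apply/orP; left; apply/eqP/eq_bigr => k _; rewrite -iterSr.
Qed.

Lemma max_sum_nd n x : max_sum n x <= max_sum n.+1 x.
Proof.
elim: n x => [|n IHn] x; first by rewrite /= le_max lexx.
rewrite [leLHS]/= [leRHS]/=; apply: le_max2 => //; by rewrite lerD2l.
Qed.

Lemma max_sum_homo m n x : (m <= n)%N -> max_sum m x <= max_sum n x.
Proof.
move=> mn; apply: (@homo_leq _ (max_sum ^~ x) (fun a b => a <= b)) => //.
  by move=> ? ? ?; exact: le_trans.
by move=> k; exact: max_sum_nd.
Qed.

Lemma integrable_max_sum n : mu.-integrable setT (EFin \o max_sum n).
Proof.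
elim: n => [|n IHn]; first exact: integrable0.
have [it _] := integral_measure_preserving IHn.
have ifM : mu.-integrable setT ((EFin \o f) \+ (EFin \o (max_sum n \o tau)))%E.
  exact: integrableD.
apply: le_integrable ifM => //.
- apply/measurable_EFinP; apply: measurable_maxr => //; apply: measurable_funD.
    by apply/measurable_EFinP; exact: measurable_int intf.
  by apply/measurable_EFinP; exact: measurable_int it.
- move=> x _ /=; rewrite lee_fin ger0_norm ?le_max ?lexx//.
  by rewrite ge_max normr_ge0 ler_norm.
Qed.

Lemma measurable_max_sum n : measurable_fun setT (max_sum n).
Proof. by apply/measurable_EFinP; exact: measurable_int (integrable_max_sum n). Qed.

Let unbdd := \bigcap_(c in [set: nat]) \bigcup_(n in [set: nat])
  [set x | c%:R < max_sum n x].

Let bdd_notin x : ~ unbdd x -> exists C : R, forall n, max_sum n x <= C.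
Proof.
move=> /existsNP[c /not_implyP[_ hc]].
by exists c%:R => n; rewrite leNgt; apply/negP => cn; apply: hc; exists n.
Qed.

Let unbddP x : unbdd x -> forall C : R, exists n, C < max_sum n x.
Proof.
move=> h C; have [n _ /= hn] := h (Num.bound `|C|) I.
exists n; apply: lt_trans hn.
exact: le_lt_trans (ler_norm _) (archi_boundP (normr_ge0 _)).
Qed.


Let measurable_unbdd : measurable unbdd.
Proof.
apply: bigcapT_measurable => c; apply: bigcup_measurable => n _.
by rewrite -[X in measurable X]setTI; apply: measurable_fun_ltr => //; exact: measurable_max_sum.
Qed.

(** The recursion for [max_sum] shows that passing from [x] to [tau x] alters the maxima by the
    single finite number [f x]. The invariance is exact, as [tau_erg] demands. *)
Let unbdd_inv : tau @^-1` unbdd = unbdd.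
Proof.
apply/seteqP; split => x /=.
- move=> h; apply: contrapT => /bdd_notin[C hC].
  have [n] := unbddP h (C - f x); rewrite ltrBlDl.
  by rewrite ltNge (le_trans _ (hC n.+1))// /= le_max lexx orbT.
- move=> h; apply: contrapT => /bdd_notin[C hC].
  have [[|n] /=] := unbddP h (Num.max 0 (f x + C)).
    by rewrite ltNge le_max lexx.
  by rewrite ltNge (le_max2 (lexx _))// lerD2l.
Qed.

(* On the event where the sums are unbounded,
   [max_sum n.+1 - max_sum n \o tau = max (- max_sum n \o tau, f)] tends to [f];
   its integrals are nonnegative, so [f] would have a nonnegative integral. *)
Lemma max_sum_bounded : (\int[mu]_x (f x)%:E < 0)%E ->
  {ae mu, forall x, exists C : R, forall n, \sum_(k < n) f (iter k tau x) <= C}.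
Proof.
move=> f_lt0; have [mu0|mu1] := tau_erg measurable_unbdd unbdd_inv.
  exists unbdd; split=> // x /= h; apply: contrapT => /bdd_notin[C hC]; apply: h.
  by exists C => n; exact: le_trans (sum_le_max_sum n x) (hC n).
exfalso; move: f_lt0; apply/negP; rewrite -leNgt.
pose g n x := max_sum n.+1 x - max_sum n (tau x).
have mg n : measurable_fun setT (g n).
  apply: measurable_funB; first exact: measurable_max_sum.
  by apply: measurableT_comp => //; exact: measurable_max_sum.
have mf : measurable_fun setT f by apply/measurable_EFinP; exact: measurable_int intf.
have gE n x : g n x = Num.max (- max_sum n (tau x)) (f x).
  by rewrite /g /= addr_maxl sub0r addrK.
(* The sequence is eventually constant: [g n x = f x] as soon as [max_sum n (tau x)] exceeds
   [- f x]. *)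
have gf x : unbdd x -> g n x @[n --> \oo] --> f x.
  move=> ux; have : unbdd (tau x) by rewrite -[unbdd]unbdd_inv in ux.
  move=> /unbddP/(_ (- f x))[N hN]; apply: cvg_near_cst; exists N => // n /= Nn.
  rewrite gE; apply/max_idPr; rewrite lerNl; apply/ltW/(lt_le_trans hN).
  exact: max_sum_homo.
have muC0 : mu (~` unbdd) = 0%E by rewrite probability_setC// mu1 subee.
have [|||||_ _ cvg_g] := @dominated_convergence _ T R mu setT measurableT
  (fun n x => (g n x)%:E) (fun x => (f x)%:E) (fun x => (`|f x|)%:E).
- by move=> n; exact/measurable_EFinP.
- exact/measurable_EFinP.
- exists (~` unbdd); split; first exact: measurableC.
    exact: muC0.
  move=> x; apply: contra_not => ux _.
  by apply: cvg_EFin; [exact: nearW|exact: gf].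
- exact: integrable_norm.
- apply: aeW => x n _; rewrite abse_EFin lee_fin gE.
  have := max_sum_ge0 n (tau x); set m := max_sum _ _ => m0.
  rewrite ler_norml le_max ge_max ler_norm andbT; apply/andP; split.
    by apply/orP; right; rewrite lerNl -normrN ler_norm.
  by rewrite (le_trans _ (normr_ge0 _))// oppr_le0.
rewrite -(cvg_lim _ cvg_g)//; apply: lime_ge; first by apply/cvg_ex; eexists; exact: cvg_g.
apply: nearW => n /=; have [it eit] := integral_measure_preserving (integrable_max_sum n).
under eq_integral do rewrite /g EFinB.
rewrite (integralB_EFin measurableT)//; last exact: integrable_max_sum.
rewrite eit sube_ge0; last by rewrite integrable_fin_num//; exact: integrable_max_sum.
apply: le_integral => //; [exact: integrable_max_sum|exact: integrable_max_sum|].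
by move=> x _; rewrite lee_fin max_sum_nd.
Qed.

End maximal_ergodic.

(** * Path spaces and independence *)

Definition path_space (I : Type) (R : realType) := g_sigma_algebraType (@cylinders I R).

Section path_space.
Context {R : realType}.

Lemma measurable_coord (I : Type) (i : I) :
  measurable_fun setT (fun x : path_space I R => x i).
Proof.
move=> _ B mB; rewrite setTI; apply: sub_sigma_algebra.
by exists i, B.
Qed.

Lemma measurable_path (I : Type) d (T : measurableType d)
    (g : T -> path_space I R) :
  (forall i, measurable_fun setT (fun w => g w i)) -> measurable_fun setT g.
Proof.
move=> mg; apply: (@measurability _ _ T (path_space I R) setT g (@cylinders I R)) => //.
move=> _ [_ [i [B [mB ->]]] <-].
by have := mg i measurableT B mB.
Qed.

(* Boxes with finitely many nontrivial sides: unlike [cylinders], a pi-system. *)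
Definition boxes : set (set (path_space nat R)) :=
  [set A | exists (n : nat) (B : nat -> set R), (forall i, measurable (B i)) /\
     A = [set x | forall i, (i < n)%N -> B i (x i)]].

Lemma setI_closed_boxes : setI_closed boxes.
Proof.
move=> _ _ [n1 [B1 [mB1 ->]]] [n2 [B2 [mB2 ->]]].
exists (maxn n1 n2), (fun i => (if (i < n1)%N then B1 i else setT) `&`
                               (if (i < n2)%N then B2 i else setT)); split.
  by move=> i; apply: measurableI; case: ifP.
apply/seteqP; split => x /=.
  by move=> [h1 h2] i _; split; case: ifP => // hi; [exact: h1|exact: h2].
move=> h; split => i hi.
  by have := (h i); rewrite leq_max hi => /(_ isT)[].
by have := (h i); rewrite leq_max hi orbT => /(_ isT)[].
Qed.

Lemma measurable_boxesE : @measurable _ (path_space nat R) = <<s boxes >>.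
Proof.
apply/seteqP; split.
  apply: smallest_sub; first exact: smallest_sigma_algebra.
  move=> _ [i [B [mB ->]]]; apply: sub_sigma_algebra.
  exists i.+1, (fun j => if j == i then B else setT); split.
    by move=> j; case: ifP.
  apply/seteqP; split => x /=; first by move=> Bx j _; case: eqP => // ->.
  by move=> /(_ i (ltnSn i)); rewrite eqxx.
apply: smallest_sub; first exact: sigma_algebra_measurable.
move=> _ [n [B [mB ->]]].
rewrite (_ : [set _ | _] = \bigcap_(i in [set i | (i < n)%N]) [set x | B i (x i)]) //.
apply: bigcap_measurableType => i _.
by have := @measurable_coord nat i measurableT (B i) (mB i); rewrite setTI.
Qed.

End path_space.

(** * Joint laws and expectations of products under independence *)

Section independent_pair.
Context {d d1 d2 : measure_display} {T : measurableType d}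
  {T1 : measurableType d1} {T2 : measurableType d2} {R : realType}.
Variables (P : probability T R) (Y : {mfun T >-> T1}) (Z : {mfun T >-> T2}).
Local Open Scope ereal_scope.

Definition independent_pair := forall A B, measurable A -> measurable B ->
  P (Y @^-1` A `&` Z @^-1` B) = P (Y @^-1` A) * P (Z @^-1` B).

Hypothesis YZ : independent_pair.

Let YZ_pair w := (Y w, Z w).

Let mYZ : measurable_fun setT YZ_pair.
Proof. exact: measurable_fun_pair. Qed.

(** Independence is the agreement of the two measures on rectangles, which determine a product
    measure. *)
Lemma joint_lawE C : measurable C ->
  (distribution P Y \x distribution P Z) C = P [set w | C (Y w, Z w)].
Proof.
by move=> mC; rewrite (product_measure_unique (m' := pushforward P YZ_pair)).
Qed.

Lemma ge0_integral_joint_law (f : T1 * T2 -> \bar R) :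
  measurable_fun setT f -> (forall z, 0 <= f z) ->
  \int[P]_w f (Y w, Z w) = \int[distribution P Y \x distribution P Z]_z f z.
Proof.
move=> mf f0; rewrite (eq_measure_integral (pushforward P YZ_pair)).
  by rewrite ge0_integral_pushforward.
by move=> C mC _; exact: joint_lawE.
Qed.

Lemma ge0_expectation_prod (f : T1 -> R) (g : T2 -> R) :
  measurable_fun setT f -> measurable_fun setT g ->
  (forall y, 0 <= f y)%R -> (forall z, 0 <= g z)%R ->
  \int[P]_w (f (Y w) * g (Z w))%:E =
  (\int[P]_w (f (Y w))%:E) * (\int[P]_w (g (Z w))%:E).
Proof.
move=> mf mg f0 g0.
rewrite (@ge0_integral_joint_law (fun z => (f z.1 * g z.2)%:E)); last 2 first.
  apply/measurable_EFinP; apply: measurable_funM; exact: measurableT_comp.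
  by move=> z; rewrite lee_fin mulr_ge0.
rewrite fubini_tonelli1; last 2 first.
  apply/measurable_EFinP; apply: measurable_funM; exact: measurableT_comp.
  by move=> z; rewrite lee_fin mulr_ge0.
rewrite /fubini_F /=.
have mEf : measurable_fun setT (fun y => (f y)%:E) by exact/measurable_EFinP.
have mEg : measurable_fun setT (fun y => (g y)%:E) by exact/measurable_EFinP.
under eq_integral => y _.
  under eq_integral do rewrite EFinM.
  rewrite ge0_integralZl//; last 2 first.
    by move=> z _; rewrite lee_fin.
    by rewrite lee_fin.
  rewrite ge0_integral_distribution//; over.
rewrite /= ge0_integralZr//; last 2 first.
  by move=> y _; rewrite lee_fin.
  by apply: integral_ge0 => w _; rewrite /= lee_fin.
by rewrite ge0_integral_distribution.
Qed.

(** The nonnegative case applied to the absolute values gives integrability of the product; Fubini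
    under the product law then factors the integral. *)
Lemma expectation_prod (f : T1 -> R) (g : T2 -> R) :
  measurable_fun setT f -> measurable_fun setT g ->
  P.-integrable setT (fun w => (f (Y w))%:E) ->
  P.-integrable setT (fun w => (g (Z w))%:E) ->
  P.-integrable setT (fun w => (f (Y w) * g (Z w))%:E) /\
  \int[P]_w (f (Y w) * g (Z w))%:E =
  (\int[P]_w (f (Y w))%:E) * (\int[P]_w (g (Z w))%:E).
Proof.
move=> mf mg intf intg.
have mfg : measurable_fun setT (fun z : T1 * T2 => (f z.1 * g z.2)%:E).
  by apply/measurable_EFinP; apply: measurable_funM; exact: measurableT_comp.
have ifg : P.-integrable setT (fun w => (f (Y w) * g (Z w))%:E).
  apply/integrableP; split; first exact: (measurableT_comp mfg mYZ).
  under eq_integral do rewrite abse_EFin normrM.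
  rewrite (@ge0_expectation_prod (Num.norm \o f) (Num.norm \o g))//;
    [|exact: measurableT_comp|exact: measurableT_comp|
     by move=> y; exact: normr_ge0|by move=> y; exact: normr_ge0].
  have /integrableP[_] := intf; have /integrableP[_] := intg.
  under eq_integral do rewrite abse_EFin.
  under [in X in _ -> X -> _]eq_integral do rewrite abse_EFin.
  move=> fy gy. rewrite lte_mul_pinfty//.
    by apply: integral_ge0 => w _; rewrite lee_fin; exact: normr_ge0.
  rewrite ge0_fin_numE//.
  by apply: integral_ge0 => w _; rewrite lee_fin; exact: normr_ge0.
split=> //.
have ifgp : (pushforward P YZ_pair).-integrable setT (fun z => (f z.1 * g z.2)%:E).
  exact: integrable_pushforward.
have ifgx : (distribution P Y \x distribution P Z).-integrable setT
    (fun z => (f z.1 * g z.2)%:E).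
  have /integrableP[_] := ifgp => ip; apply/integrableP; split => //.
  rewrite (eq_measure_integral (pushforward P YZ_pair))// => C mC _.
  exact: joint_lawE.
transitivity (\int[pushforward P YZ_pair]_z (f z.1 * g z.2)%:E).
  by rewrite integral_pushforward.
transitivity (\int[distribution P Y \x distribution P Z]_z (f z.1 * g z.2)%:E).
  by apply: eq_measure_integral => C mC _; exact/esym/joint_lawE.
rewrite -integral12_prod_meas1//= /fubini_F /=.
have mEf : measurable_fun setT (fun y => (f y)%:E) by exact/measurable_EFinP.
have mEg : measurable_fun setT (fun y => (g y)%:E) by exact/measurable_EFinP.
have idg : (distribution P Z).-integrable setT (EFin \o g).
  exact: integrable_pushforward.
have idf : (distribution P Y).-integrable setT (EFin \o f).
  exact: integrable_pushforward.
under eq_integral => y _.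
  under eq_integral do rewrite EFinM.
  rewrite integralZl//; over.
have eg : \int[distribution P Z]_z (g z)%:E = \int[P]_w (g (Z w))%:E.
  exact: integral_distribution.
have ef : \int[distribution P Y]_y (f y)%:E = \int[P]_w (f (Y w))%:E.
  exact: integral_distribution.
rewrite /= -eg -ef.
have : \int[distribution P Z]_z (g z)%:E \is a fin_num by exact: integrable_fin_num.
by move=> /fineK <-; rewrite integralZr.
Qed.

End independent_pair.

Section affine_null.
Context {d d1 : measure_display} {T : measurableType d}
  {T1 : measurableType d1} {R : realType}.
Variables (P : probability T R) (Z : {mfun T >-> T1}) (Y : {RV P >-> R}).
Hypothesis ZY : independent_pair P Z Y.
Hypothesis Y_atomless : forall r, P (Y @^-1` [set r]) = 0%E.

(** Fubini, slicing at [Z = z]: when [a z != 0] the form vanishes for the single value [- b z / a z]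
    of [Y], which has probability zero. *)
Lemma affine_null (a b : T1 -> R) :
  measurable_fun setT a -> measurable_fun setT b ->
  {ae P, forall w, a (Z w) != 0 -> a (Z w) * Y w + b (Z w) != 0}.
Proof.
move=> ma mb.
pose C : set (T1 * R) := [set z | (a z.1 != 0) && (a z.1 * z.2 + b z.1 == 0)].
have mC : measurable C.
  rewrite (_ : C = setT `&`
      (fun z => (a z.1 != 0) && (a z.1 * z.2 + b z.1 == 0)) @^-1` [set true]); last first.
    by rewrite setTI.
  have ma1 : measurable_fun setT (fun z : T1 * R => a z.1) by exact: measurableT_comp.
  have mb1 : measurable_fun setT (fun z : T1 * R => b z.1) by exact: measurableT_comp.
  apply: measurable_and => //.
    by apply: measurable_neg; apply: measurable_fun_eqr.
  by apply: measurable_fun_eqr => //; apply: measurable_funD => //; exact: measurable_funM.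
exists [set w | C (Z w, Y w)]; split.
- have := @measurable_fun_pair _ _ _ _ _ _ Z Y; move=> /(_ _ _)/(_ measurableT C mC).
  by rewrite setTI; apply; exact: measurable_funP.
- rewrite -(joint_lawE ZY mC) /product_measure1; apply: integral0_eq => z _ /=.
  have [az0|az0] := eqVneq (a z) 0.
    rewrite (_ : xsection C z = set0) ?measure0//; apply/seteqP; split => y //=.
    by rewrite xsectionE /C /= az0 eqxx.
  apply/eqP; rewrite -measure_le0 -(Y_atomless (- b z / a z)).
  apply: le_measure; rewrite ?inE//; first exact: measurable_xsection.
  move=> y /=; rewrite xsectionE /C /= az0 /= => /eqP e.
  by apply: (mulfI az0); rewrite mulrCA divff// mulr1; apply/eqP; rewrite -addr_eq0 e.
- move=> w /= /not_implyP[az /negP]; rewrite negbK /C /= => e.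
  by rewrite az.
Qed.

End affine_null.

(** * Independence of the present innovation from the past *)

Section causal_independence.
Context {d : measure_display} {T : measurableType d} {R : realType}.
Variable P : probability T R.

Definition past (X : int -> {RV P >-> R}) (t : int) (w : T) : path_space nat R :=
  fun j => X (t - j.+1%:Z) w.

Lemma measurable_past X t : measurable_fun setT (past X t).
Proof. by apply: measurable_path => i; exact: measurable_funP. Qed.

HB.instance Definition _ X t :=
  isMeasurableFun.Build _ _ _ _ (past X t) (measurable_past X t).

Lemma ae_le_measure (C D : set T) : measurable C -> measurable D ->
  {ae P, forall w, C w -> D w} -> (P C <= P D)%E.
Proof.
move=> mC mD [N [mN N0 hN]]; rewrite -[leRHS]adde0 -N0.
apply: le_trans (measureU2 _ mD mN); apply: le_measure; rewrite ?inE//.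
  exact: measurableU.
move=> w Cw; have [Dw|nDw] := pselect (D w); first by left.
by right; apply: hN => /(_ Cw).
Qed.

Lemma ae_eq_measure (C D : set T) : measurable C -> measurable D ->
  {ae P, forall w, C w <-> D w} -> P C = P D.
Proof.
move=> mC mD CD; apply/eqP; rewrite eq_le; apply/andP; split;
  by apply: ae_le_measure => //; apply: filterS CD => w [].
Qed.

(** Causality represents the past of [X] only almost surely; this carries independence over from the
    representation. *)
Lemma independent_pair_ae d1 d2 (T1 : measurableType d1) (T2 : measurableType d2)
    (Z Z' : {mfun T >-> T1}) (Y : {mfun T >-> T2}) :
  {ae P, forall w, Z w = Z' w} -> independent_pair P Z' Y -> independent_pair P Z Y.
Proof.
move=> ZZ' Z'Y A B mA mB.
have mZA : measurable (Z @^-1` A) by exact: measurable_funPTI.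
have mZA' : measurable (Z' @^-1` A) by exact: measurable_funPTI.
have mYB : measurable (Y @^-1` B) by exact: measurable_funPTI.
have -> : P (Z @^-1` A) = P (Z' @^-1` A).
  by apply: ae_eq_measure => //; apply: filterS ZZ' => w /= ->.
rewrite -Z'Y//; apply: ae_eq_measure; [exact: measurableI..|].
by apply: filterS ZZ' => w /= ->.
Qed.

Variable xi : int -> {RV P >-> R}.
Hypothesis xi_indep : mutually_independent xi.

(** For fixed [B], both sides are finite measures in [A]. They agree on boxes by mutual independence
    of finitely many innovations, and boxes form a generating pi-system. *)
Lemma independent_past_innovation t : independent_pair P (past xi t) (xi t).
Proof.
move=> A B mA mB.
have mE : measurable (xi t @^-1` B) by exact: measurable_funPTI.
pose m1 := pushforward (mrestr P mE) (past xi t).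
pose r := NngNum (fine_ge0 (measure_ge0 P (xi t @^-1` B))).
pose m2 := mscale r (distribution P (past xi t)).
have rE : r%:num%:E = P (xi t @^-1` B) by rewrite /= fineK// fin_num_measure.
suff -> : P (past xi t @^-1` A `&` xi t @^-1` B) = m2 A.
  by rewrite /m2 /mscale rE muleC.
rewrite -[LHS]/(m1 A).
apply: (measure_unique boxes (fun _ => setT) ) => //.
- exact: measurable_boxesE.
- exact: setI_closed_boxes.
- move=> _; exists 0%N, (fun _ => setT); split => //.
  by apply/seteqP; split.
- by rewrite bigcup_const//; exists 0%N.
- move=> _ [n [C [mC ->]]].
  set A0 := [set x | _].
  change (P (past xi t @^-1` A0 `&` xi t @^-1` B) =
    (r%:num%:E * P (past xi t @^-1` A0))%E).
  rewrite rE /A0.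
  pose s := [seq t - j.+1%:Z | j <- iota 0 n].
  (* One family indexed by time: [B] at time [t], and side [C j] at time [t - j.+1], whose lag is
     recovered as [(absz (t - k)).-1]. *)
  pose D k := if k == t then B else C (absz (t - k)).-1.
  have mD k : measurable (D k) by rewrite /D; case: ifP.
  have us : uniq s.
    rewrite map_inj_uniq ?iota_uniq// => i j /addrI /oppr_inj [].
    by [].
  have ts : t \notin s.
    apply/mapP => -[j _ /eqP]; rewrite eq_sym -subr_eq0 addrAC subrr sub0r.
    by rewrite oppr_eq0.
  have Ds j : D (t - j.+1%:Z) = C j.
    rewrite /D; case: eqP => [/eqP|_]; last by rewrite opprB addrC subrK.
    by rewrite -subr_eq0 addrAC subrr sub0r oppr_eq0.
  have DE : \bigcap_(i in [set` s]) (xi i @^-1` D i) =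
      past xi t @^-1` [set x | forall i, (i < n)%N -> C i (x i)].
    apply/seteqP; split => w /= h.
      move=> i ni; have := h (t - i.+1%:Z); rewrite /= Ds; apply.
      by apply: map_f; rewrite mem_iota.
    move=> _ /= /mapP[j + ->]; rewrite mem_iota add0n => /= jn.
    by rewrite Ds; exact: h.
  have := xi_indep (s := t :: s) (B := D); rewrite /= ts us => /(_ isT mD).
  rewrite big_cons -xi_indep// DE /= {2}/D eqxx => <-; congr (P _).
  rewrite -DE; apply/seteqP; split => w /=.
    move=> [h1 h2] k /=; rewrite inE => /predU1P[->|ks]; last exact: h1.
    by rewrite /D eqxx.
  move=> h; split; first by move=> k ks; apply: h; rewrite /= inE ks orbT.
  by have := h t; rewrite /= /D eqxx; apply; rewrite inE eqxx.
- move=> _; change (P (past xi t @^-1` setT `&` xi t @^-1` B) < +oo)%E.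
  apply: (le_lt_trans (probability_le1 _ _)); last by rewrite ltry.
  by apply: measurableI => //; exact: measurable_funPTI.
Qed.

Variable X : int -> {RV P >-> R}.
Hypothesis X_causal : causal xi X.

(** By causality the past of [X] is almost surely a measurable function [Phi] of the past of [xi],
    which is independent of [xi t]. *)
Lemma independent_past t : independent_pair P (past X t) (xi t).
Proof.
have [H HP] := choice X_causal.
(* [X (t - j.+1)] depends on the innovations at times [t - j.+1 - k], which sit at index [j + k] in
   [past xi t]. *)
pose Phi (z : path_space nat R) : path_space nat R :=
  fun j => H (t - j.+1%:Z) (fun k => z (j + k)%N).
have mPhi : measurable_fun setT Phi.
  apply: measurable_path => j.
  have mH : measurable_fun setT (H (t - j.+1%:Z) : path_space nat R -> R).
    by move=> _ B mB; rewrite setTI; exact: (HP _).1.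
  apply: (measurableT_comp mH); apply: measurable_path => k.
  exact: measurable_coord.
have mPhip : measurable_fun setT (Phi \o past xi t) by exact: measurableT_comp.
pose Z' : {mfun T >-> path_space nat R} :=
  HB.pack (Phi \o past xi t) (isMeasurableFun.Build _ _ _ _ _ mPhip).
apply: (@independent_pair_ae _ _ _ _ (past X t) Z').
  have : {ae P, forall w, forall j : nat, X (t - j.+1%:Z) w =
      H (t - j.+1%:Z) (fun k => xi (t - j.+1%:Z - k%:Z) w)}.
    by apply/ae_foralln => j; exact: (HP _).2.
  apply: filterS => w h; apply/funext => j; rewrite [LHS]h /= /Phi /past.
  congr (H _ _); apply/funext => k; congr (xi _ w).
  by rewrite -addrA -opprD -PoszD addSn.
move=> A B mA mB; have := mPhi measurableT A mA; rewrite setTI => mPA.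
exact: (independent_past_innovation t mPA mB).
Qed.

End causal_independence.

(** * Square integrability and stationarity *)

Section square_integrable.
Context {d : measure_display} {T : measurableType d} {R : realType}.
Variable P : probability T R.

Definition square_integrable (Y : T -> R) :=
  measurable_fun setT Y /\ P.-integrable setT (fun w => (Y w ^+ 2)%:E).

Lemma le_integrable_real (Y Z : T -> R) : measurable_fun setT Y ->
  (forall w, `|Y w| <= Z w) -> P.-integrable setT (fun w => (Z w)%:E) ->
  P.-integrable setT (fun w => (Y w)%:E).
Proof.
move=> mY YZ; apply: le_integrable => //; first exact/measurable_EFinP.
by move=> w _; rewrite !abse_EFin lee_fin (le_trans (YZ w))// ler_norm.
Qed.

Lemma integrable_addr (Y Z : T -> R) : P.-integrable setT (fun w => (Y w)%:E) ->
  P.-integrable setT (fun w => (Z w)%:E) ->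
  P.-integrable setT (fun w => (Y w + Z w)%:E).
Proof. by move=> iY iZ; exact: (integrableD measurableT iY iZ). Qed.

Lemma integrable_scaler (c : R) (Y : T -> R) :
  P.-integrable setT (fun w => (Y w)%:E) ->
  P.-integrable setT (fun w => (c * Y w)%:E).
Proof. by move=> iY; exact: (integrableZl measurableT c iY). Qed.

Lemma square_integrable_cst c : square_integrable (fun=> c).
Proof.
split; first exact: measurable_cst.
exact: (finite_measure_integrable_cst P (c ^+ 2)).
Qed.

Lemma square_integrableD Y Z : square_integrable Y -> square_integrable Z ->
  square_integrable (fun w => Y w + Z w).
Proof.
move=> [mY iY] [mZ iZ]; split; first exact: measurable_funD.
apply: (@le_integrable_real _ (fun w => 2 * Y w ^+ 2 + 2 * Z w ^+ 2)).
- by apply: measurable_funX; exact: measurable_funD.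
- move=> w; rewrite ger0_norm ?sqr_ge0//; have := sqr_ge0 (Y w - Z w); nra.
- by apply: integrable_addr; exact: integrable_scaler.
Qed.

Lemma square_integrableZ c Y : square_integrable Y ->
  square_integrable (fun w => c * Y w).
Proof.
move=> [mY iY]; split; first exact: measurable_funM.
by under eq_fun do rewrite exprMn; exact: integrable_scaler.
Qed.

Lemma square_integrableB Y Z : square_integrable Y -> square_integrable Z ->
  square_integrable (fun w => Y w - Z w).
Proof.
move=> iY iZ; under eq_fun do rewrite -mulN1r.
by apply: square_integrableD => //; exact: square_integrableZ.
Qed.

Lemma square_integrable_norm Y : square_integrable Y ->
  square_integrable (fun w => `|Y w|).
Proof.
move=> [mY iY]; split; first exact: measurableT_comp.
by under eq_fun do rewrite real_normK ?num_real//.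
Qed.

Lemma square_integrable_sum (F : nat -> T -> R) (r : seq nat) :
  (forall i, square_integrable (F i)) ->
  square_integrable (fun w => \sum_(i <- r) F i w).
Proof.
move=> iF; elim: r => [|i r IHr].
  by under eq_fun do rewrite big_nil; exact: square_integrable_cst.
by under eq_fun do rewrite big_cons; exact: square_integrableD.
Qed.

Lemma square_integrableM Y Z : square_integrable Y -> square_integrable Z ->
  P.-integrable setT (fun w => (Y w * Z w)%:E).
Proof.
move=> [mY iY] [mZ iZ].
apply: (@le_integrable_real _ (fun w => Y w ^+ 2 + Z w ^+ 2)).
- exact: measurable_funM.
- move=> w; rewrite ler_norml; apply/andP; split.
    by have := sqr_ge0 (Y w + Z w); nra.
  by have := sqr_ge0 (Y w - Z w); nra.
- exact: integrable_addr.
Qed.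

Lemma square_integrable_integrable Y : square_integrable Y ->
  P.-integrable setT (fun w => (Y w)%:E).
Proof.
move=> iY; have := square_integrableM iY (square_integrable_cst 1).
by under eq_fun do rewrite mulr1.
Qed.

End square_integrable.

Section sample_path.
Context {d : measure_display} {T : measurableType d} {R : realType}.
Variable P : probability T R.
Implicit Type X : int -> {RV P >-> R}.

Lemma measurable_sample_path X :
  measurable_fun setT (sample_path X : T -> path_space int R).
Proof. by apply: measurable_path => i; exact: measurable_funP. Qed.

(** Retyped with a measurable codomain, so that the sample path can carry the structure of a
    measurable function and has a law. *)
Definition path_rv X : T -> path_space int R := sample_path X.

HB.instance Definition _ X :=
  isMeasurableFun.Build _ _ _ _ (path_rv X) (measurable_sample_path X).

Lemma measurable_path_shift (h : int) :
  measurable_fun setT (path_shift h : path_space int R -> path_space int R).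
Proof. by apply: measurable_path => i; exact: measurable_coord. Qed.

Variable X : int -> {RV P >-> R}.
Hypothesis X_stationary : strictly_stationary X.

Lemma ge0_integral_shift (h : int) (f : path_space int R -> \bar R) :
  measurable_fun setT f -> (forall x, 0 <= f x)%E ->
  (\int[P]_w f (path_shift h (path_rv X w)) = \int[P]_w f (path_rv X w))%E.
Proof.
move=> mf f0.
pose tau : path_space int R -> path_space int R := path_shift h.
have mtau : measurable_fun setT tau := measurable_path_shift h.
have mft : measurable_fun setT (f \o tau) by exact: measurableT_comp.
pose mu := distribution P (path_rv X).
transitivity (\int[mu]_x (f \o tau) x)%E.
  by rewrite ge0_integral_distribution// => x; exact: f0.
transitivity (\int[pushforward mu tau]_x f x)%E.
  by rewrite (ge0_integral_pushforward mtau)// => x _; exact: f0.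
transitivity (\int[mu]_x f x)%E; last by rewrite ge0_integral_distribution.
apply: eq_measure_integral => A mA _; apply/esym; exact: (X_stationary h mA).
Qed.

Hypothesis X_L2 : ('E_P[fun w => (X 0 w ^+ 2)%R] < +oo)%E.

Lemma square_integrable_stationary t : square_integrable P (X t).
Proof.
have m2 (s : int) : measurable_fun setT (fun x : path_space int R => (x s ^+ 2)%:E).
  by apply/measurable_EFinP; apply: measurable_funX; exact: measurable_coord.
split; first exact: measurable_funP.
apply/integrableP; split.
  by apply/measurable_EFinP; apply: measurable_funX; exact: measurable_funP.
under eq_integral do rewrite abse_EFin ger0_norm ?sqr_ge0//.
have := @ge0_integral_shift t (fun x => (x 0 ^+ 2)%:E) (m2 0).
rewrite /path_shift /path_rv /sample_path add0r => -> //.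
  by move: X_L2; rewrite unlock.
by move=> x; rewrite lee_fin sqr_ge0.
Qed.

End sample_path.

(** An atom at [r] would keep the distribution function to the left of [r] below its value at [r] by
    the mass of the atom; letting [r - 1/(n+1)] tend to [r] contradicts continuity. *)
Lemma continuous_cdf_atomless d (T : measurableType d) (R : realType)
    (P : probability T R) (Y : {RV P >-> R}) :
  continuous (cdf Y) -> forall r, P (Y @^-1` [set r]) = 0%E.
Proof.
move=> cY r; apply/eqP; rewrite -measure_le0.
have mr : measurable (Y @^-1` [set r]) by exact: measurable_funPTI.
have cdf_fin x : cdf Y x \is a fin_num by exact: fin_num_measure.
have le_cdf (n : nat) :
    (cdf Y (r - n.+1%:R^-1) <= cdf Y r - P (Y @^-1` [set r]))%E.
  rewrite leeBrDr ?fin_num_measure//.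
  have mn : measurable (Y @^-1` `]-oo, r - n.+1%:R^-1]) by exact: measurable_funPTI.
  rewrite -[leLHS](measureU _ mn mr); last first.
    apply/seteqP; split => // w [] /=; rewrite in_itv/= => /[swap] ->.
    by rewrite leNgt ltrBlDr ltrDl invr_gt0 ltr0n.
  apply: le_measure; rewrite ?inE; [exact: measurableU|exact: measurable_funPTI|].
  move=> w [] /=; rewrite !in_itv/=; last by move=> ->.
  by move/le_trans; apply; rewrite gerBl invr_ge0.
have : (cdf Y r <= cdf Y r - P (Y @^-1` [set r]))%E.
  have cv : cdf Y (r - n.+1%:R^-1) @[n --> \oo] --> cdf Y r.
    have rn : (r - n.+1%:R^-1 : R) @[n --> \oo] --> r.
      by rewrite -[X in _ --> X]subr0; apply: cvgB; [exact: cvg_cst|exact: cvg_harmonic].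
    exact: (cvg_comp _ _ rn (cY r)).
  by apply: cvge_to_le cv _; exact: nearW.
by rewrite leeBrDr ?fin_num_measure// -[leRHS]adde0 leeD2lE.
Qed.

(** * Affine forms in the past *)

Section affine_form.
Context {R : realType} (p : nat).

(** A past [z] stores lag [i] at index [i.-1], while [c i] is the coefficient of lag [i] and [c 0]
    the constant term. *)
Definition affine (c : nat -> R) (z : nat -> R) : R :=
  c 0%N + \sum_(1 <= i < p.+1) c i * z i.-1.

Lemma larch_sigmaE (theta : 'rV[R]_p.+1) (x : int -> R) t :
  larch_sigma theta x t = affine (coef theta) (fun j => x (t - j.+1%:Z)).
Proof.
rewrite /larch_sigma /affine; congr (_ + _); apply: eq_big_nat => i /andP[i1 _].
by rewrite prednK.
Qed.

Lemma affineB c c' z : affine (fun j => c j - c' j) z = affine c z - affine c' z.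
Proof.
rewrite /affine opprD addrACA -sumrB; congr (_ + _).
by apply: eq_bigr => i _; rewrite mulrBl.
Qed.

Lemma affineD c c' z : affine (fun j => c j + c' j) z = affine c z + affine c' z.
Proof.
rewrite /affine addrACA -big_split/=; congr (_ + _).
by apply: eq_bigr => i _; rewrite mulrDl.
Qed.

Lemma measurable_affine c :
  measurable_fun setT (affine c : path_space nat R -> R).
Proof.
apply: measurable_funD => //; apply: measurable_sum => i.
by apply: measurable_funM => //; exact: measurable_coord.
Qed.

End affine_form.


(** * Uniform comparison of the losses near a parameter *)

Section gap.
Context {R : realType} (p : nat).
Implicit Types (a c : nat -> R) (x : int -> R).

(** The residual at time 0 with all [p] lags available; shifting the path gives the residual at any
    other time. *)
Definition deviation c x : R :=
  `|x 0| - `|affine p c (fun j => x (0 - j.+1%:Z))|.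

(** Lipschitz constant of the affine form at time 0 with respect to the largest change of a
    coefficient. The index [i.-1.+1] matches the one produced by [affine]. *)
Definition envelope x : R := 1 + \sum_(1 <= i < p.+1) `|x (0 - i.-1.+1%:Z)|.

(* Up to the margin [eta], an upper bound of the loss of parameter [a] minus the
   loss of any parameter within [eps] of [c], uniform in that parameter. *)
Definition gap a c (eps eta : R) x : R :=
  deviation a x ^+ 2 - deviation c x ^+ 2 +
  2 * eps * (`|deviation c x| * envelope x) + eta.

Lemma envelope_ge0 x : 0 <= envelope x.
Proof. by rewrite addr_ge0// sumr_ge0. Qed.

Lemma deviation_close c c' eps x : (forall j, (j <= p)%N -> `|c' j - c j| <= eps) ->
  `|deviation c x - deviation c' x| <= eps * envelope x.
Proof.
move=> cc'; rewrite /deviation; set z := (fun j => _).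
have -> : `|x 0| - `|affine p c z| - (`|x 0| - `|affine p c' z|) =
  `|affine p c' z| - `|affine p c z| by ring.
apply: le_trans (ler_dist_dist _ _) _; rewrite -affineB /affine /envelope mulrDr mulr1.
apply: le_trans (ler_normD _ _) _; apply: lerD; first exact: cc'.
apply: le_trans (ler_norm_sum _ _ _) _; rewrite mulr_sumr.
apply: ler_sum_nat => i /andP[_ ip].
by rewrite normrM ler_wpM2r//; exact: cc'.
Qed.

(** From [D^2 - D'^2 = 2 D (D - D') - (D - D')^2] the last square is dropped, leaving a bound linear
    in [eps]. *)
Lemma sqr_deviation_gap a c c' (eps eta : R) x : 0 <= eps ->
  (forall j, (j <= p)%N -> `|c' j - c j| <= eps) ->
  deviation a x ^+ 2 - deviation c' x ^+ 2 <= gap a c eps eta x - eta.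
Proof.
move=> eps0 /deviation_close - /(_ x).
rewrite /gap addrK; set D := deviation c x; set D' := deviation c' x.
move=> h; have := envelope_ge0 x; set V := envelope x in h * => V0.
suff : D ^+ 2 - D' ^+ 2 <= 2 * eps * (`|D| * V) by lra.
have -> : D ^+ 2 - D' ^+ 2 = 2 * (D * (D - D')) - (D - D') ^+ 2 by ring.
have : D * (D - D') <= `|D| * (eps * V).
  by apply: le_trans (ler_norm _) _; rewrite normrM ler_wpM2l.
by have := sqr_ge0 (D - D'); nra.
Qed.

Lemma measurable_deviation c : measurable_fun setT (deviation c : path_space int R -> R).
Proof.
apply: measurable_funB; apply: measurableT_comp => //; first exact: measurable_coord.
apply: measurable_funD => //; apply: measurable_sum => i.
by apply: measurable_funM => //; exact: measurable_coord.
Qed.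

Lemma measurable_gap a c eps eta :
  measurable_fun setT (gap a c eps eta : path_space int R -> R).
Proof.
apply: measurable_funD => //; apply: measurable_funD.
  by apply: measurable_funB; apply: measurable_funX; exact: measurable_deviation.
apply: measurable_funM => //; apply: measurable_funM.
  by apply: measurableT_comp => //; exact: measurable_deviation.
apply: measurable_funD => //; apply: measurable_sum => i.
by apply: measurableT_comp => //; exact: measurable_coord.
Qed.

(** After time [p] each loss difference is at most the gap minus [eta]. The gap sums stay bounded
    and the first [p] terms contribute a bounded amount, so the accumulated margin [eta] eventually
    dominates, uniformly in [theta]. *)
Lemma larch_contrast_lt (theta0 : 'rV[R]_p.+1) c (eps eta : R) x (C : R) :
  0 <= eps -> 0 < eta ->
  (forall n, \sum_(k < n) gap (coef theta0) c eps eta (path_shift k%:Z x) <= C) ->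
  \forall n \near \oo, forall theta : 'rV[R]_p.+1,
    (forall j, (j <= p)%N -> `|coef theta j - c j| <= eps) ->
    larch_contrast theta0 x n < larch_contrast theta x n.
Proof.
move=> eps0 eta0 sumC.
pose loss (theta : 'rV[R]_p.+1) (t : nat) := (`|x t%:Z| - `|coef theta 0%N +
       \sum_(1 <= j < (minn p t.-1).+1) coef theta j * x (t%:Z - j%:Z)|) ^+ 2.
have lossE (theta : 'rV[R]_p.+1) t : (p < t)%N ->
    loss theta t = deviation (coef theta) (path_shift t%:Z x) ^+ 2.
  move=> pt; rewrite /loss /deviation /path_shift add0r; congr ((_ - `|_ + _|) ^+ 2).
  rewrite (minn_idPl _); last by lia.
  apply: eq_big_nat => j /andP[j1 _]; rewrite prednK//; congr (_ * x _); ring.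
(* [C1] bounds the terms with truncated lags, the competing losses being nonnegative. [C2] is the
   part of the gap sum at times [0] to [p], which has to be removed from the bound [C]. *)
pose C1 := \sum_(1 <= t < p.+1) loss theta0 t.
pose C2 := \sum_(k < p.+1) gap (coef theta0) c eps eta (path_shift k%:Z x).
have [M hM] : exists M : nat, C1 + C - C2 < eta * M%:R.
  exists (Num.bound `|(C1 + C - C2) / eta|); rewrite mulrC -ltr_pdivrMr//.
  exact: le_lt_trans (ler_norm _) (archi_boundP (normr_ge0 _)).
exists (p.+1 + M)%N => // n /= nM theta close.
have n0 : (0 < n)%N by lia.
rewrite /larch_contrast ltr_pM2l ?invr_gt0 ?ltr0n// -subr_gt0 -sumrB.
rewrite -oppr_lt0 -sumrN.
have -> : \sum_(1 <= t < n.+1) - (loss theta t - loss theta0 t) =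
   \sum_(1 <= t < p.+1) (loss theta0 t - loss theta t) +
   \sum_(p.+1 <= t < n.+1) (loss theta0 t - loss theta t).
  rewrite -big_cat_nat//=; last by lia.
  by apply: eq_bigr => t _; rewrite opprB.
have h1 : \sum_(1 <= t < p.+1) (loss theta0 t - loss theta t) <= C1.
  by apply: ler_sum => t _; rewrite gerBl sqr_ge0.
have h2 : \sum_(p.+1 <= t < n.+1) (loss theta0 t - loss theta t) <=
    \sum_(p.+1 <= t < n.+1) (gap (coef theta0) c eps eta (path_shift t%:Z x) - eta).
  apply: ler_sum_nat => t /andP[pt _]; rewrite !lossE//.
  exact: sqr_deviation_gap.
have h3 : \sum_(p.+1 <= t < n.+1) (gap (coef theta0) c eps eta (path_shift t%:Z x) - eta)
   <= C - C2 - eta * M%:R.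
  rewrite sumrB sumr_const_nat; have := sumC n.+1.
  rewrite -(big_mkord xpredT (fun k => gap (coef theta0) c eps eta (path_shift k%:Z x))).
  rewrite (big_cat_nat (n := p.+1))//=; last by lia.
  rewrite big_mkord -/C2.
  have : eta * M%:R <= eta *+ (n.+1 - p.+1).
    by rewrite -[leRHS]mulr_natr ler_wpM2l ?(ltW eta0)// ler_nat; lia.
  lra.
lra.
Qed.

End gap.
(** * Zeros of affine forms in the past of a LARCH process *)

Section larch_process.
Context {d : measure_display} {T : measurableType d} {R : realType}.
Variables (P : probability T R) (p : nat) (xi X : int -> {RV P >-> R}).
Variable a : nat -> R.
Hypothesis xi_indep : mutually_independent xi.
Hypothesis xi_id : identically_distributed xi.
Hypothesis xi_continuous : continuous (cdf (xi 0)).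
Hypothesis xi_abs1 : ('E_P[fun w => `|xi 0 w|%R] = 1)%E.
Hypothesis xi_centered : ('E_P[xi 0%R] = 0)%E.
Hypothesis X_causal : causal xi X.
Hypothesis X_stationary : strictly_stationary X.
Hypothesis X_L2 : ('E_P[fun w => (X 0 w ^+ 2)%R] < +oo)%E.
Hypothesis X_eq : forall t,
  {ae P, forall w, X t w = xi t w * affine p a (past X t w)}.
Hypothesis a0_gt0 : 0 < a 0%N.

Lemma innovation_atomless t r : P (xi t @^-1` [set r]) = 0%E.
Proof.
rewrite -(continuous_cdf_atomless xi_continuous r).
by have := xi_id t 0 (measurable_set1 r).
Qed.

Lemma innovation_abs t : (\int[P]_w (`|xi t w|)%:E = 1)%E.
Proof.
have mabs : measurable_fun setT (fun y : R => (`|y|)%:E).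
  by apply/measurable_EFinP; exact: normr_measurable.
rewrite -[LHS](ge0_integral_distribution (xi t) mabs)//.
rewrite (eq_measure_integral (distribution P (xi 0))).
  by rewrite (ge0_integral_distribution (xi 0) mabs)// -xi_abs1 unlock.
by move=> A mA _; exact: xi_id.
Qed.

Lemma integrable_innovation t : P.-integrable setT (fun w => (xi t w)%:E).
Proof.
apply/integrableP; split; first by apply/measurable_EFinP; exact: measurable_funP.
by under eq_integral do rewrite abse_EFin; rewrite innovation_abs ltry.
Qed.

Lemma innovation_centered t : (\int[P]_w (xi t w)%:E = 0)%E.
Proof.
have mE : measurable_fun setT (@EFin R) by exact: EFin_measurable.
rewrite -[LHS](integral_distribution (X := xi t) mE (integrable_innovation t)).
rewrite (eq_measure_integral (distribution P (xi 0))).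
  rewrite (integral_distribution (X := xi 0) mE (integrable_innovation 0)).
  by rewrite -xi_centered unlock.
by move=> A mA _; exact: xi_id.
Qed.

Lemma past_shift t m :
  past X (t - m%:Z) = fun w j => past X t w (m + j)%N.
Proof.
apply/funext => w; apply/funext => j; rewrite /past.
by congr (X _ w); rewrite -addrA -opprD -PoszD addnS.
Qed.

Lemma measurable_drop m :
  measurable_fun setT ((fun z j => z (m + j)%N) : path_space nat R -> path_space nat R).
Proof. by apply: measurable_path => i; exact: measurable_coord. Qed.

(* The first lag [i] with [c i != 0] brings in [xi (t - i)], which is atomless
   and independent of everything else occurring in the form. *)
Lemma affine_zero_lag (c : nat -> R) (i : nat) t : (1 <= i <= p)%N -> c i != 0 ->
  (forall j, (1 <= j < i)%N -> c j = 0) ->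
  {ae P, forall w, affine p c (past X t w) = 0 ->
    affine p a (past X (t - i%:Z) w) = 0}.
Proof.
move=> /andP[i1 ip] ci0 cj0.
(* The part of the form older than lag [i], read from the past at time [t - i], where lag [j]
   becomes lag [j - i]. *)
pose b (z : path_space nat R) := c 0%N + \sum_(i.+1 <= j < p.+1) c j * z (j - i).-1.
have mb : measurable_fun setT b.
  apply: measurable_funD => //; apply: measurable_sum => j.
  by apply: measurable_funM => //; exact: measurable_coord.
have ma : measurable_fun setT (fun z : path_space nat R => c i * affine p a z).
  by apply: measurable_funM => //; exact: measurable_affine.
have := affine_null (independent_past xi_indep X_causal (t - i%:Z))
  (innovation_atomless (t - i%:Z)) ma mb.
apply: filterS2 (X_eq (t - i%:Z)) => w Xw h c0; apply/eqP.
have E : affine p c (past X t w) =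
    c i * affine p a (past X (t - i%:Z) w) * xi (t - i%:Z) w + b (past X (t - i%:Z) w).
  rewrite /b /affine (big_cat_nat (n := i)) ?(leqW ip)//=.
  rewrite big_nat_cond big1 ?add0r; last first.
    by move=> j /andP[ij _]; rewrite cj0// mul0r.
  rewrite big_ltn ?ltnS// [past X t w i.-1](_ : _ = X (t - i%:Z) w); last first.
    by rewrite /past prednK.
  rewrite Xw /affine addrCA; congr (_ + _); first by ring.
  congr (_ + _); apply: eq_big_nat => j /andP[ij _]; rewrite past_shift.
  by congr (c j * past X t w _); lia.
by apply: contraT => s0; move: h; rewrite mulf_neq0// => /(_ isT)/negP[]; rewrite -E c0.
Qed.

Lemma square_integrable_affine c t : square_integrable P (fun w => affine p c (past X t w)).
Proof.
apply: square_integrableD; first exact: square_integrable_cst.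
apply: square_integrable_sum => i; apply: square_integrableZ.
exact: square_integrable_stationary.
Qed.

Let sigma_zero t := [set w | affine p a (past X t w) = 0].

Let measurable_sigma_zero t : measurable (sigma_zero t).
Proof.
have := measurableT_comp (measurable_affine p a) (measurable_past X t).
move=> /(_ measurableT _ (measurable_set1 0)); rewrite setTI.
exact.
Qed.

Let sigma_zero_stationary s t : P (sigma_zero s) = P (sigma_zero t).
Proof.
pose B : set (int -> R) := [set x | affine p a (fun j => x (s - j.+1%:Z)) = 0].
have mB : <<s @cylinders int R >> B.
  have mt : measurable_fun setT (fun x : path_space int R =>
      affine p a (fun j => x (s - j.+1%:Z))).
    apply: measurable_funD => //; apply: measurable_sum => i.
    by apply: measurable_funM => //; exact: measurable_coord.
  by have := mt measurableT _ (measurable_set1 0); rewrite setTI.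
have := X_stationary (t - s) mB; rewrite /sigma_zero => E.
transitivity (P (sample_path X @^-1` B)) => //; rewrite E; congr (P _).
apply/seteqP; split => w /=; rewrite /B /= /path_shift /sample_path /past => <-;
  by congr (affine _ _ _); apply/funext => j; congr (X _ w); ring.
Qed.

(** The martingale difference property: [xi t] is centered and independent of the past. *)
Lemma innovation_past_centered (g : path_space nat R -> R) t :
  measurable_fun setT g -> P.-integrable setT (fun w => (g (past X t w))%:E) ->
  P.-integrable setT (fun w => (g (past X t w) * xi t w)%:E) /\
  (\int[P]_w (g (past X t w) * xi t w)%:E = 0)%E.
Proof.
move=> mg ig; have := expectation_prod (independent_past xi_indep X_causal t)
  mg (@measurable_id _ R setT) ig (integrable_innovation t).
by rewrite innovation_centered mule0.
Qed.

Lemma integral_sum_eq0 (r : seq nat) (F : nat -> T -> R) :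
  (forall j, P.-integrable setT (fun w => (F j w)%:E) /\
    (\int[P]_w (F j w)%:E = 0)%E) ->
  P.-integrable setT (fun w => (\sum_(j <- r) F j w)%:E) /\
  (\int[P]_w (\sum_(j <- r) F j w)%:E = 0)%E.
Proof.
move=> hF; elim: r => [|j r [IHi IHe]].
  under eq_fun do rewrite big_nil.
  by split; [exact: integrable0|exact: integral0].
have [iF eF] := hF j; under eq_fun do rewrite big_cons; split.
  exact: integrable_addr.
under eq_integral do rewrite EFinD.
by rewrite integralD// eF IHe adde0.
Qed.

(* With [i] the first lag such that [a i != 0], [sigma t = 0] forces
   [sigma (t - i) = 0], and stationarity makes the two events almost surely
   equal; hence [sigma t = 0] is almost surely an event [B] of the remote past.
   Then [0 = E(sigma t; B) = a 0 * P B], the innovations being centered. *)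
Lemma sigma_neq0 t : {ae P, forall w, affine p a (past X t w) != 0}.
Proof.
have [[i ip ai0]|noi] := pselect (exists2 i, (1 <= i <= p)%N & a i != 0); last first.
  apply: aeW => w; rewrite /affine big_nat_cond big1 ?addr0 ?gt_eqF// => j /andP[jp _].
  have [->|aj0] := eqVneq (a j) 0; first by rewrite mul0r.
  by exfalso; apply: noi; exists j.
have exi : exists j, (1 <= j <= p)%N && (a j != 0) by exists i; rewrite ip.
have [{ip ai0}i /andP[ip ai0] imin] := ex_minnP exi.
have step s : {ae P, forall w, sigma_zero s w -> sigma_zero (s - i%:Z) w}.
  apply: affine_zero_lag => // j /andP[j1 ji]; apply/eqP; apply: contraTT isT => aj0.
  have := imin j; rewrite j1 aj0 (leq_trans (ltnW ji))//; last by case/andP: ip.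
  by rewrite leqNgt ji => /(_ isT).
have steps k : {ae P, forall w, sigma_zero t w -> sigma_zero (t - (i * k)%:Z) w}.
  elim: k => [|k IHk]; first by apply: aeW => w; rewrite muln0 subr0.
  apply: filterS2 IHk (step (t - (i * k)%:Z)) => w h1 h2 /h1/h2.
  by rewrite -addrA -opprD -PoszD mulnS addnC.
(* After [p] backward steps of length [i >= 1] the lag [N] is at least [p], so [B] belongs to the
   strict past at each time [t - j] with [1 <= j <= p]. *)
pose N := (i * p)%N; have pN : (p <= N)%N by rewrite leq_pmull//; case/andP: ip.
pose A := sigma_zero t; pose B := sigma_zero (t - N%:Z).
have mA : measurable A by exact: measurable_sigma_zero.
have mB : measurable B by exact: measurable_sigma_zero.
have PAB : P (A `&` B) = P B.
  rewrite /B -(sigma_zero_stationary t) -/A; apply: ae_eq_measure => //.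
    exact: measurableI.
  by apply: filterS (steps p) => w h; split => [[]//|Aw]; split => //; exact: h.
(* [A] is almost surely included in [B] and has the same probability, which gives the converse
   inclusion. *)
have BA : {ae P, forall w, B w -> A w}.
  exists (B `\` A); split; first exact: measurableD.
    rewrite measureD// ?ltey_eq ?fin_num_measure//.
    by rewrite -[X in (_ - X)%E]/(P (B `&` A)) setIC PAB subee// fin_num_measure.
  by move=> w /= /not_implyP.
(* The event [B] as read from [past X (t - j)], for [j <= N]. *)
pose Z j : set (path_space nat R) := [set z | affine p a (fun k => z (N - j + k)%N) = 0].
have mZ j : measurable (Z j).
  have := measurableT_comp (measurable_affine p a) (measurable_drop (N - j)).
  by move=> /(_ measurableT _ (measurable_set1 0)); rewrite setTI.
pose g j (z : path_space nat R) := affine p a z * \1_(Z j) z.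
have mg j : measurable_fun setT (g j).
  by apply: measurable_funM; [exact: measurable_affine|exact: measurable_indic].
have ig j s : P.-integrable setT (fun w => (g j (past X s w))%:E).
  apply: (@le_integrable_real _ _ _ _ _ (fun w => `|affine p a (past X s w)|)).
  - exact: measurableT_comp (mg j) (measurable_past X s).
  - move=> w; rewrite /g normrM; apply: ler_piMr; first exact: normr_ge0.
    by rewrite indicE normr_nat lern1 leq_b1.
  - exact: square_integrable_integrable (square_integrable_norm (square_integrable_affine a s)).
(* For [1 <= j <= p] this is almost surely [a j * X (t - j)] restricted to [B], written as a
   function of the past times an innovation so that its mean vanishes. *)
pose F j w := a j * (g j (past X (t - j%:Z) w) * xi (t - j%:Z) w).
have iF j : P.-integrable setT (fun w => (F j w)%:E) /\ (\int[P]_w (F j w)%:E = 0)%E.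
  have [iG eG] := innovation_past_centered (mg j) (ig j (t - j%:Z)).
  split; first exact: integrable_scaler.
  under eq_integral do rewrite EFinM.
  by rewrite integralZl// eG mule0.
have [iSF eSF] := integral_sum_eq0 (index_iota 1 p.+1) iF.
have i1B : P.-integrable setT (fun w => (\1_B w : R)%:E) by exact: integrable_indic.
have sum0 : {ae P, forall w, a 0%N * \1_B w + \sum_(1 <= j < p.+1) F j w = 0}.
  have Xj : {ae P, forall w, forall j : nat, X (t - j%:Z) w =
      xi (t - j%:Z) w * affine p a (past X (t - j%:Z) w)}.
    by apply/ae_foralln => j; exact: X_eq.
  apply: filterS2 BA Xj => w BAw Xw.
  transitivity (affine p a (past X t w) * \1_B w).
    rewrite /affine mulrDl mulr_suml; congr (_ + _).
    apply: eq_big_nat => j /andP[j1 jp]; rewrite /F /g -!mulrA; congr (_ * _).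
    rewrite [past X t w j.-1](_ : _ = X (t - j%:Z) w) ?Xw; last by rewrite /past prednK.
    have -> : \1_B w = \1_(Z j) (past X (t - j%:Z) w) :> R by
      rewrite !indicE; congr ((nat_of_bool _)%:R); apply/idP/idP;
      rewrite !inE /Z /B /sigma_zero/= => <-;
      congr (affine _ _ _); apply/funext => k; congr (X _ w); lia.
    by ring.
  have [Bw|nBw] := pselect (B w); first by rewrite (BAw Bw) mul0r.
  by rewrite indicE memNset// mulr0.
have PB0 : P B = 0%E.
  have : (\int[P]_w ((a 0%N)%:E * (\1_B w)%:E) = 0)%E.
    rewrite -[LHS]adde0 -[X in (_ + X)%E]eSF -integralD//; last exact: integrable_scaler.
    rewrite -[RHS](@integral0 _ _ _ P setT); apply: ae_eq_integral => //.
      apply: emeasurable_funD; [exact: measurable_int (integrable_scaler _ i1B)|].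
      exact: measurable_int iSF.
    by apply: filterS sum0 => w h _; rewrite -EFinM -EFinD h.
  rewrite integralZl// integral_indic// setIT => /eqP.
  by rewrite mule_eq0 eqe gt_eqF//= => /eqP.
exists A; split => //; first by rewrite (sigma_zero_stationary _ (t - N%:Z)).
by move=> w /= /negP; rewrite negbK => /eqP.
Qed.

(** If some lag has a nonzero coefficient, the first such lag [i] turns a zero of the form into a
    zero of the volatility at time [t - i], a null event. Otherwise the form is a nonzero
    constant. *)
Lemma affine_neq0 (c : nat -> R) t : (exists2 j, (j <= p)%N & c j != 0) ->
  {ae P, forall w, affine p c (past X t w) != 0}.
Proof.
move=> [j0 j0p cj0].
have [[i ip ci0]|noi] := pselect (exists2 i, (1 <= i <= p)%N & c i != 0); last first.
  have zero j : (1 <= j <= p)%N -> c j = 0.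
    by move=> jp; apply: contrapT => /eqP ?; apply: noi; exists j.
  have c0 : c 0%N != 0 by case: j0 j0p cj0 => // j0 j0p; rewrite zero ?eqxx.
  apply: aeW => w; rewrite /affine big_nat_cond big1 ?addr0// => j /andP[jp _].
  by rewrite zero ?mul0r.
have exi : exists j, (1 <= j <= p)%N && (c j != 0) by exists i; rewrite ip.
have [{ip ci0}i /andP[ip ci0] imin] := ex_minnP exi.
have := @affine_zero_lag c i t ip ci0; move=> lag.
apply: filterS2 (lag _) (sigma_neq0 (t - i%:Z)).
  by move=> w h; apply: contra => /eqP/h ->.
move=> j /andP[j1 ji]; apply/eqP; apply: contraTT isT => cj.
have := imin j; rewrite j1 cj (leq_trans (ltnW ji))//; last by case/andP: ip.
by rewrite leqNgt ji => /(_ isT).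
Qed.

(** Equal absolute values would make the form of [a - c] or of [a + c] vanish. Neither has all
    coefficients zero: the first because [c] differs from [a], the second because its constant term
    is positive. *)
Lemma abs_affine_separation (c : nat -> R) t : 0 < c 0%N ->
  (exists2 j, (j <= p)%N & c j != a j) ->
  (0 < \int[P]_w ((`|affine p a (past X t w)| - `|affine p c (past X t w)|) ^+ 2)%:E)%E.
Proof.
move=> c0 [j jp cj].
rewrite lt_neqAle integral_ge0 ?andbT; last by move=> w _; rewrite lee_fin sqr_ge0.
apply/negP => /eqP/esym int0.
pose D w := (`|affine p a (past X t w)| - `|affine p c (past X t w)|) ^+ 2.
have mform e : measurable_fun setT (fun w => `|affine p e (past X t w)|).
  by have [] := square_integrable_norm (square_integrable_affine e t).
have mD : measurable_fun setT (fun w => (D w)%:E).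
  by apply/measurable_EFinP; apply: measurable_funX; exact: measurable_funB.
have D0 : {ae P, forall w, D w = 0}.
  have /ae_eq_integral_abs : (\int[P]_w `|(D w)%:E| = 0)%E.
    by under eq_integral do rewrite abse_EFin ger0_norm ?sqr_ge0//.
  by move=> /(_ measurableT mD); apply: filterS => w /(_ I) [].
have diff := @affine_neq0 (fun j => a j - c j) t.
have sum := @affine_neq0 (fun j => a j + c j) t.
have : {ae P, forall w, False}.
  apply: filterS3 D0 (diff _) (sum _).
  - move=> w /eqP; rewrite sqrf_eq0 subr_eq0 eqr_norm2 affineB affineD.
    by rewrite subr_eq0 addr_eq0 => /orP[] ->.
  - by exists j => //; rewrite subr_eq0 eq_sym.
  - by exists 0%N => //; rewrite gt_eqF// addr_gt0.
move=> [N [mN N0 NT]]; have : P setT = 0%E.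
  by apply/eqP; rewrite -measure_le0 -N0; apply: le_measure; rewrite ?inE// => w _; exact: NT.
by rewrite probability_setT => /eqP; rewrite eqe oner_eq0.
Qed.

(** Write [s e] for the absolute value of the form of [e], so that [|X t| = |xi t| * s a]. The
    difference of squares is [g - g * |xi t| - (s a - s c)^2] with [g = 2 * s a * (s a - s c)]; the
    first two terms cancel in mean because [|xi t|] has mean 1 and is independent of the past. *)
Lemma contrast_mean (c : nat -> R) t :
  (\int[P]_w ((`|X t w| - `|affine p a (past X t w)|) ^+ 2 -
             (`|X t w| - `|affine p c (past X t w)|) ^+ 2)%:E =
  - \int[P]_w ((`|affine p a (past X t w)| - `|affine p c (past X t w)|) ^+ 2)%:E)%E.
Proof.
pose s e w := `|affine p e (past X t w)|.
have is_ e : square_integrable P (s e).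
  exact: square_integrable_norm (square_integrable_affine e t).
have iX := square_integrable_norm (square_integrable_stationary X_stationary X_L2 t).
have isq : P.-integrable setT (fun w => ((s a w - s c w) ^+ 2)%:E).
  by have [] := square_integrableB (is_ a) (is_ c).
have idev e : P.-integrable setT (fun w => ((`|X t w| - s e w) ^+ 2)%:E).
  by have [] := square_integrableB iX (is_ e).
pose g (z : path_space nat R) := 2 * (`|affine p a z| * (`|affine p a z| - `|affine p c z|)).
have mg : measurable_fun setT g.
  apply: measurable_funM => //; apply: measurable_funM.
    by apply: measurableT_comp => //; exact: measurable_affine.
  by apply: measurable_funB; apply: measurableT_comp => //; exact: measurable_affine.
have ig : P.-integrable setT (fun w => (g (past X t w))%:E).
  apply: integrable_scaler.
  exact: square_integrableM (is_ a) (square_integrableB (is_ a) (is_ c)).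
have mn : measurable_fun setT (@Num.norm R R) by exact: normr_measurable.
have iabs : P.-integrable setT (fun w => (`|xi t w|)%:E).
  exact: integrable_norm (integrable_innovation t).
have [igx egx] := expectation_prod (independent_past xi_indep X_causal t) mg mn ig iabs.
move: egx; rewrite innovation_abs mule1 => egx.
rewrite -[LHS]/(\int[P]_w ((`|X t w| - s a w) ^+ 2 - (`|X t w| - s c w) ^+ 2)%:E)%E.
transitivity (\int[P]_w ((g (past X t w))%:E - (g (past X t w) * `|xi t w|)%:E
    - ((s a w - s c w) ^+ 2)%:E))%E.
  apply: ae_eq_integral => //.
  - by under eq_fun do rewrite EFinB; apply: measurable_int (integrableB _ (idev a) (idev c)).
  - by apply: measurable_int (integrableB _ (integrableB _ ig igx) isq).
  apply: filterS (X_eq t) => w Xw _; rewrite -!EFinB /g -/(s a w) -/(s c w) Xw normrM -/(s a w).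
  by congr (_%:E); ring.
rewrite integralB//; last exact: integrableB.
by rewrite integralB// egx subee ?integrable_fin_num// sub0e.
Qed.

Lemma gap_mean_lt0 (c : nat -> R) : 0 < c 0%N ->
  (exists2 j, (j <= p)%N & c j != a j) ->
  exists eps eta : R, [/\ 0 < eps, 0 < eta,
    P.-integrable setT (fun w => (gap p a c eps eta (path_rv X w))%:E) &
    (\int[P]_w (gap p a c eps eta (path_rv X w))%:E < 0)%E].
Proof.
have siX := square_integrable_stationary X_stationary X_L2.
move=> c0 ca; have := contrast_mean c 0; have := abs_affine_separation 0 c0 ca.
set I := (\int[P]_w _)%E => I0 mean.
have idev e : square_integrable P (fun w => deviation p e (path_rv X w)).
  apply: square_integrableB; first exact: square_integrable_norm (siX 0).
  exact: square_integrable_norm (square_integrable_affine e 0).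
have ienv : square_integrable P (fun w => envelope p (path_rv X w)).
  apply: square_integrableD; first exact: square_integrable_cst.
  by apply: square_integrable_sum => i; exact: square_integrable_norm (siX _).
have iI : I \is a fin_num.
  have [_] := square_integrableB (square_integrable_norm (square_integrable_affine a 0))
    (square_integrable_norm (square_integrable_affine c 0)).
  exact: integrable_fin_num.
have iJ := square_integrableM (square_integrable_norm (idev c)) ienv.
set J := fun w => _ in iJ.
pose m := fine I; pose j := fine (\int[P]_w J w)%E.
have m0 : 0 < m by rewrite /m fine_gt0// I0 ltey_eq iI.
have j0 : 0 <= j.
  by apply/fine_ge0/integral_ge0 => w _; rewrite /J lee_fin mulr_ge0// envelope_ge0.
have mE : I = m%:E by rewrite fineK.
have jE : (\int[P]_w J w = j%:E)%E by rewrite fineK// integrable_fin_num.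
have eps0 : 0 < m / (8 * (j + 1)) by rewrite divr_gt0// mulr_gt0// ltr_pwDr.
(* The mean of the gap is [- m + 2 * eps * j + eta]. This [eps] keeps the middle term at most
   [m / 4], even when [j = 0], and [eta = m / 4] leaves a mean of at most [- m / 2]. *)
exists (m / (8 * (j + 1))), (m / 4); set eps := m / _ in eps0 *.
have [_ ia] := idev a; have [_ ic] := idev c.
have iac : P.-integrable setT (fun w => (deviation p a (path_rv X w) ^+ 2 -
    deviation p c (path_rv X w) ^+ 2)%:E).
  exact: (integrableB measurableT ia ic).
have iJe := integrable_scaler (2 * eps) iJ.
have icst : P.-integrable setT (fun w : T => (m / 4)%:E).
  exact: (finite_measure_integrable_cst P (m / 4)).
have igap := integrable_addr (integrable_addr iac iJe) icst.
split=> //; first by rewrite divr_gt0.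
rewrite /gap; under eq_integral do rewrite EFinD.
rewrite integralD//; last exact: (integrable_addr iac iJe).
under [X in (X + _)%E]eq_integral do rewrite EFinD.
rewrite integralD//.
under [X in (_ + X + _)%E]eq_integral do rewrite EFinM.
have -> : (\int[P]__ (m / 4)%:E = (m / 4)%:E)%E.
  by rewrite integral_cst// -[RHS]mule1 -(probability_setT P).
rewrite integralZl// -/J jE.
rewrite [X in (X + _ + _)%E](_ : _ = - I)%E; last first.
  exact: mean.
rewrite mE -EFinN -EFinM -!EFinD lte_fin.
have : eps * (8 * (j + 1)) = m by rewrite divfK// gt_eqF// mulr_gt0// ltr_pwDr.
nra.
Qed.

End larch_process.
(** * Consistency *)

Lemma iter_path_shift (R : realType) k (x : int -> R) :
  iter k (path_shift 1) x = path_shift k%:Z x.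
Proof.
elim: k => [|k IHk]; first by apply/funext => t; rewrite /path_shift addr0.
rewrite iterS IHk; apply/funext => t; rewrite /path_shift.
by congr (x _); rewrite -addrA -PoszD add1n.
Qed.

(** Stationarity and ergodicity concern the law of the path, so [max_sum_bounded] is applied on path
    space with the unit shift, and the null set is pulled back to [T]. *)
Lemma stationary_sums_bounded d (T : measurableType d) (R : realType)
    (P : probability T R) (X : int -> {RV P >-> R}) (f : path_space int R -> R) :
  strictly_stationary X -> ergodic X -> measurable_fun setT f ->
  P.-integrable setT (fun w => (f (path_rv X w))%:E) ->
  (\int[P]_w (f (path_rv X w))%:E < 0)%E ->
  {ae P, forall w, exists C : R,
    forall n, \sum_(k < n) f (path_shift k%:Z (sample_path X w)) <= C}.
Proof.
move=> Xs Xe mf intf f_lt0.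
pose tau : path_space int R -> path_space int R := path_shift 1.
pose mu := distribution P (path_rv X).
have mEf : measurable_fun setT (fun x => (f x)%:E) by exact/measurable_EFinP.
have [] := @max_sum_bounded _ _ R mu tau (measurable_path_shift 1) _ _ f.
- by move=> A mA; apply/esym/(Xs 1 A).
- by move=> A mA; exact: Xe.
- exact: (integrable_pushforward (@measurable_sample_path _ _ _ P X) mEf intf measurableT).
- suff -> : (\int[mu]_x (f x)%:E = \int[P]_w (f (path_rv X w))%:E)%E by [].
  exact: (integral_distribution mEf intf).
move=> N [mN N0 hN]; exists (path_rv X @^-1` N); split.
- by rewrite -[_ @^-1` _]setTI; exact: measurable_sample_path.
- exact: N0.
move=> w /= nb; apply: hN => /= -[C hC]; apply: nb; exists C => n.
by have := hC n; under eq_bigr do rewrite iter_path_shift.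
Qed.

(* Near covering, applied to the filter of the sets of pairs [(w, n)] that contain,
   for almost every [w], all large [n], turns the finite subcover of the compact set
   into a single null set. *)
Lemma argmin_consistent d (T : measurableType d) (R : realType) (P : probability T R)
    (V : topologicalType) (Theta : set V) (theta_star : V) (theta_hat : nat -> T -> V)
    (loss : V -> T -> nat -> R) :
  compact Theta -> Theta theta_star ->
  (forall n w, (1 <= n)%N -> Theta (theta_hat n w) /\
     forall theta, Theta theta -> loss (theta_hat n w) w n <= loss theta w n) ->
  (forall theta, Theta theta -> theta != theta_star ->
    exists2 U, nbhs theta U & {ae P, forall w, \forall n \near \oo,
      forall theta', U theta' -> loss theta_star w n < loss theta' w n}) -> 
  forall U, open U -> U theta_star ->
    {ae P, forall w, \forall n \near \oo, U (theta_hat n w)}.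
Proof.
move=> cT Tstar argmin sep U oU Ustar.
pose F : set_system (T * nat) :=
  [set A | {ae P, forall w, \forall n \near \oo, A (w, n)}].
have FF : Filter F.
  split.
  - by apply: aeW => w; exists 0%N.
  - move=> A B; rewrite /F /= => FA FB; apply: filterS2 FA FB => w.
    exact: filterS2.
  - move=> A B AB; rewrite /F /= => FA; apply: filterS FA => w.
    by apply: filterS => n; exact: AB.
(* The minimizer has to avoid this compact set, each point of which has a neighborhood where the
   loss eventually exceeds that of [theta_star]. *)
have cK : compact (Theta `&` ~` U).
  by apply: compact_closedI => //; exact: open_closedC.
have cover : {ae P, forall w, \forall n \near \oo, Theta `&` ~` U `<=`
    (fun theta => (1 <= n)%N -> theta_hat n w <> theta)}.
  have /compact_near_coveringP/(_ _ F (fun i theta =>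
    (1 <= i.2)%N -> theta_hat i.2 i.1 <> theta) FF) := cK.
  apply => theta [Ttheta nU].
  have [|W Wtheta hW] := sep theta Ttheta.
    by apply/eqP => e; apply: nU; rewrite e.
  exists (W, [set i | forall theta', W theta' ->
      loss theta_star i.1 i.2 < loss theta' i.1 i.2]); first by split.
  move=> [theta' [w n]] /= [Wt h] n1 e; have := h _ Wt.
  by rewrite ltNge -e (argmin n w n1).2.
apply: filterS cover => w cover.
apply: filterS2 cover (nbhs_infty_gt 0) => n hn n0; apply: contrapT => nU.
exact: (hn (theta_hat n w) (conj (argmin n w n0).1 nU) n0).
Qed.
Lemma coef_neq (R : realType) p (theta theta' : 'rV[R]_p.+1) : theta != theta' ->
  exists2 j, (j <= p)%N & coef theta j != coef theta' j.
Proof.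
move=> neq; apply: contrapT => h; move/eqP: neq; apply; apply/rowP => i.
apply/eqP; apply: contrapT => /negP ti; apply: h; exists (i : nat).
  by rewrite -ltnS.
by rewrite /coef inord_val.
Qed.

Lemma nbhs_coef (R : realType) p (theta : 'rV[R]_p.+1) (eps : R) : 0 < eps ->
  nbhs theta [set theta' | forall j, (j <= p)%N ->
    `|coef theta' j - coef theta j| <= eps].
Proof.
move=> eps0; apply: filterS (nbhsx_ballx theta eps eps0) => theta' [_ b] j _.
by rewrite distrC ltW//; have := b ord0 (inord j); rewrite -ball_normE.
Qed.

Theorem corollary3p1 (d : measure_display) (T : measurableType d)
  (R : realType) (P : probability T R) (p : nat) (p_ge1 : (1 <= p)%N)
  (xi : int -> {RV P >-> R})
  (xi_iid : iid xi)
  (xi_symmetric : symmetric_rv (xi 0))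
  (xi_continuous : continuous (cdf (xi 0)))
  (xi_abs1 : ('E_P[fun w => `|xi 0 w|%R] = 1)%E)
  (xi_centered : ('E_P[xi 0%R] = 0)%E)
  (xi_L2 : ('E_P[fun w => (xi 0 w ^+ 2)%R] < +oo)%E)
  (Theta : set 'rV[R]_p.+1)
  (Theta_compact : compact Theta)
  (Theta_sub : Theta `<=` larch_params (xi 0))
  (theta_star : 'rV[R]_p.+1)
  (theta_star_in : Theta theta_star)
  (X : int -> {RV P >-> R})
  (X_larch : stationary_larch theta_star xi X)
  (theta_hat : nat -> T -> 'rV[R]_p.+1)
  (theta_hat_argmin : forall (n : nat) (w : T), (1 <= n)%N ->
    is_argmin Theta (fun theta => larch_contrast theta (sample_path X w) n)
      (theta_hat n w)) :
  {ae P, forall w, theta_hat n w @[n --> \oo] --> theta_star}.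
Proof.
have [X_eq X_stat X_erg X_causal X_L2] := X_larch.
have [xi_indep xi_id] := xi_iid.
have X_affine t : {ae P, forall w,
    X t w = xi t w * affine p (coef theta_star) (past X t w)}.
  by apply: filterS (X_eq t) => w ->; rewrite larch_sigmaE.
have [a0_gt0 _] := Theta_sub _ theta_star_in.
have sep theta : Theta theta -> theta != theta_star ->
    exists2 U, nbhs theta U & {ae P, forall w, \forall n \near \oo,
      forall theta', U theta' -> larch_contrast theta_star (sample_path X w) n <
        larch_contrast theta' (sample_path X w) n}.
  move=> Ttheta neq; have [c0_gt0 _] := Theta_sub _ Ttheta.
  have [eps [eta [eps0 eta0 igap gap_lt0]]] := gap_mean_lt0 xi_indep xi_id
    xi_continuous xi_abs1 xi_centered X_causal X_stat X_L2 X_affine a0_gt0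
    c0_gt0 (coef_neq neq).
  eexists; first exact: (nbhs_coef theta eps0).
  have := stationary_sums_bounded X_stat X_erg
    (measurable_gap p (coef theta_star) (coef theta) eps eta) igap gap_lt0.
  apply: filterS => w [C hC]; apply: filterS (larch_contrast_lt (ltW eps0) eta0 hC).
  by move=> n h theta' close; exact: h.
have consistent := argmin_consistent (P := P)
  (loss := fun theta w n => larch_contrast theta (sample_path X w) n)
  Theta_compact theta_star_in theta_hat_argmin sep.
(* Each neighborhood of [theta_star] comes with its own null set; the countable base of balls of
   radius [1/(k+1)] merges them into one. *)
have : {ae P, forall w (k : nat), \forall n \near \oo,
    (ball theta_star k.+1%:R^-1)^° (theta_hat n w)}.
  apply/ae_foralln => k; apply: consistent; first exact: open_interior.
  by apply: nbhsx_ballx; rewrite invr_gt0.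
apply: filterS => w h; apply/cvg_ballP => e e0.
have [k ke] : exists k : nat, k.+1%:R^-1 < e.
  exists (Num.bound e^-1); rewrite -[ltRHS]invrK ltf_pV2 ?posrE ?invr_gt0//.
  apply: lt_trans (archi_boundP _) _; first by rewrite invr_ge0 ltW.
  by rewrite ltr_nat.
apply: filterS (h k) => n /interior_subset; apply: le_ball; exact: ltW.
Qed.
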